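(* Let $V$ be a complex vector space with basis $|n\rangle$, $n=0,1,2,\dots$, and let $X,Z$ be linear operators on $V$ satisfying $$ZX-XZ=Z^2$$ (a representation, with $\Delta=0$, of the algebra with defining relation $[\mathcal Z,\mathcal X]=\mathcal Z^2+\Delta$) and acting tridiagonally, $$X|n\rangle=c_n|n-1\rangle+b_n|n\rangle+a_n|n+1\rangle,\qquad Z|n\rangle=u_n|n-1\rangle+v_n|n\rangle+w_n|n+1\rangle,$$ with $c_0=u_0=0$, $c_n,u_n\neq0$ for $n\ge1$ and $a_n,w_n\ne0$ for $n\ge0$. Let $\delta_0=a_0/w_0$, $\phi_0=c_1/u_1-1$ and $\tilde b_0=b_0-\tfrac12(\delta_0+\phi_0+1)v_0$. Assume $\phi_0-\delta_0\notin\{-1,-2,-3,\dots\}$, and that the normalization $v_0=\dfrac{2}{\phi_0-\delta_0+1}$, $\tilde b_0=0$ holds. Let $p_n(x)$ be the monic polynomials defined by $p_{-1}=0$, $p_0=1$ and $$x\,p_n(x)=p_{n+1}(x)+b_n\,p_n(x)+a_{n-1}c_n\,p_{n-1}(x),\qquad n\ge0.$$ Then, for all $n\ge 0$, $p_n$ is the monic Jacobi polynomial $$p_n(x)=\frac{2^n\,n!}{(n+\alpha+\beta+1)_n}\,P_n^{(\alpha,\beta)}(x),\qquad \alpha=-\delta_0-1,\quad \beta=\phi_0 .$$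
   Context: $(y)_n=y(y+1)\cdots(y+n-1)$ denotes the Pochhammer symbol, $(y)_0=1$. The Jacobi polynomials are $P_n^{(\alpha,\beta)}(x)=\frac{(\alpha+1)_n}{n!}\,{}_2F_1\!\left(-n,\,n+\alpha+\beta+1;\,\alpha+1;\,\frac{1-x}{2}\right)$. The term $a_{n-1}c_n p_{n-1}$ is understood to be $0$ for $n=0$. The polynomials $p_n$ are the monic ''eigenfunctions of $X$'': if $\langle x|$ is a dual eigenvector with $\langle x|X=x\langle x|$ and $q_n(x)=\langle x|n\rangle$ (normalized by $q_0=1$), then $p_n(x)=\left(\prod_{i=0}^{n-1}a_i\right)q_n(x)$ satisfies the stated recurrence. For a representation as in the claim, the ratios satisfy $c_n/u_n=\phi_0+n$ for $n\ge1$ and $a_n/w_n=\delta_0-n$ for $n\ge0$, so $\phi_0,\delta_0,v_0,b_0$ are the free parameters. *)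

(* Defs.v *)
From HB Require Import structures.
From mathcomp Require Import all_boot all_order all_algebra.
From mathcomp Require Import reals complex.

Set Implicit Arguments.
Unset Strict Implicit.
Unset Printing Implicit Defensive.

Import GRing.Theory.
Local Open Scope ring_scope.

(* Testing linear independence on initial segments is enough for a family
   indexed by nat. *)
Definition is_basis (F : fieldType) (V : lmodType F) (e : nat -> V) : Prop :=
  (forall (n : nat) (x : nat -> F),
     \sum_(i < n) x i *: e i = 0 -> forall i, (i < n)%N -> x i = 0) /\
  (forall v : V, exists (n : nat) (x : nat -> F), v = \sum_(i < n) x i *: e i).

(* Rising factorial (y)_n. *)
Definition pochhammer (F : fieldType) (y : F) (n : nat) : F :=
  \prod_(i < n) (y + i%:R).

Lemma pochhammer_opp_nat (F : fieldType) (n k : nat) :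
  (n < k)%N -> pochhammer (- n%:R : F) k = 0.
Proof.
by move=> lt_nk; rewrite /pochhammer (bigD1 (Ordinal lt_nk)) //= addNr mul0r.
Qed.

(* The series 2F1(-n, b; c; z), evaluated at a polynomial z; it stops at k = n
   by pochhammer_opp_nat.  It is meaningful when (c)_k != 0 for all k <= n. *)
Definition hyp2F1_neg (F : fieldType) (n : nat) (b c : F) (z : {poly F}) :
    {poly F} :=
  \sum_(k < n.+1)
    (pochhammer (- n%:R) k * pochhammer b k / (pochhammer c k * k`!%:R))
      *: z ^+ k.

Definition jacobi (F : fieldType) (n : nat) (alpha beta : F) : {poly F} :=
  (pochhammer (alpha + 1) n / n`!%:R)
    *: hyp2F1_neg n (n%:R + alpha + beta + 1) (alpha + 1) (2^-1 *: (1 - 'X)).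

(* Main.v *)
(** Comparing the coordinates of ZX - XZ = Z^2 in the basis e gives, with
    K = phi0 - delta0 and s_n = u_(n+1) w_n,
      a_n = (delta0 - n) w_n,   c_n = (phi0 + n) u_n,
      (K + 2n + 3) v_(n+1) = (K + 2n - 1) v_n,
      b_n = (delta0 + phi0 + 1) v_n / 2,
      (K + 2n) s_n - (K + 2n + 4) s_(n+1) = v_(n+1)^2.
    These determine b_n and a_(n-1) c_n, which turn out to be the recurrence
    coefficients of the monic Jacobi polynomials; that recurrence is an identity
    of rational functions between the coefficients in powers of (1 - X) / 2. *)

Require Import Defs.
From mathcomp Require Import all_boot all_order all_algebra.
From mathcomp Require Import reals complex.
From mathcomp Require Import ring.

Import GRing.Theory.
Local Open Scope ring_scope.
Local Open Scope complex_scope.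

(** * Coordinates of the relation ZX - XZ = Z^2 *)

(** The lower entry is tested by [j.+1 == n] rather than [j == n.-1], so that it drops out at n = 0,
    where [e n.-1] is [e 0]. *)
Definition tridiag {F : fieldType} (u v w : nat -> F) (n j : nat) : F :=
  u n *+ (j.+1 == n) + v n *+ (j == n) + w n *+ (j == n.+1).

Lemma sum_tridiag (F : fieldType) (V : lmodType F) (e : nat -> V)
    (u v w : nat -> F) (n N : nat) :
  u 0%N = 0 -> (n.+1 < N)%N ->
  u n *: e n.-1 + v n *: e n + w n *: e n.+1
  = \sum_(j < N) tridiag u v w n j *: e j.
Proof.
move=> u0 ltnN.
have delta k x : (k < N)%N -> \sum_(j < N) (x *+ (j == k :> nat)) *: e j = x *: e k.
  move=> ltkN; rewrite (bigD1 (Ordinal ltkN)) //= eqxx big1 ?addr0 // => i.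
  by rewrite -val_eqE /= => /negbTE ->; rewrite scale0r.
rewrite /tridiag.
under eq_bigr => i _ do rewrite !scalerDl.
rewrite !big_split /= !delta ?(ltnW ltnN) //; congr (_ + _ + _).
case: n ltnN => [|n] ltnN /=.
  by rewrite u0 scale0r big1 // => i _; rewrite scale0r.
by rewrite delta //; do 2!apply: ltnW.
Qed.

Section Coordinates.

Variables (F : fieldType) (V : lmodType F) (e : nat -> V) (X Z : {linear V -> V}).
Variables a b c u v w : nat -> F.
Hypotheses (he : is_basis e) (hZX : forall x : V, Z (X x) - X (Z x) = Z (Z x)).
Hypothesis hX :
  forall n : nat, X (e n) = c n *: e n.-1 + b n *: e n + a n *: e n.+1.
Hypothesis hZ :
  forall n : nat, Z (e n) = u n *: e n.-1 + v n *: e n + w n *: e n.+1.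
Hypotheses (hc0 : c 0%N = 0) (hu0 : u 0%N = 0).

(** The three groups are the i-th coordinates of Z X e_n, X Z e_n and Z Z e_n. All three vectors lie
    in the span of e_0, ..., e_(n+2), whence the bound [n.+3], and these vectors are independent. *)
Lemma comm_coord n i : (i < n.+3)%N ->
  (c n * tridiag u v w n.-1 i + b n * tridiag u v w n i
     + a n * tridiag u v w n.+1 i)
  - (u n * tridiag c b a n.-1 i + v n * tridiag c b a n i
     + w n * tridiag c b a n.+1 i)
  = u n * tridiag u v w n.-1 i + v n * tridiag u v w n i
     + w n * tridiag u v w n.+1 i.
Proof.
case: he => free_e _; move=> lti; apply/eqP; rewrite -subr_eq0; apply/eqP.
pose comb (x y z : F) (T : nat -> nat -> F) (i : nat) :=
  x * T n.-1 i + y * T n i + z * T n.+1 i.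
apply: (free_e n.+3 (fun i => comb (c n) (b n) (a n) (tridiag u v w) i
  - comb (u n) (v n) (w n) (tridiag c b a) i
  - comb (u n) (v n) (w n) (tridiag u v w) i) _ i lti).
under eq_bigr => j _ do rewrite !scalerBl.
rewrite !sumrB.
have combE x y z (u' v' w' : nat -> F) (u0 : u' 0%N = 0) (Y : {linear V -> V})
    (hY : forall n, Y (e n) = u' n *: e n.-1 + v' n *: e n + w' n *: e n.+1) :
  \sum_(j < n.+3) comb x y z (tridiag u' v' w') j *: e j
  = Y (x *: e n.-1 + y *: e n + z *: e n.+1).
  rewrite !linearD !linearZ /= !hY.
  rewrite !(@sum_tridiag _ _ _ _ _ _ _ n.+3) //; last by case: (n) => // k; apply: ltnW.
  rewrite !scaler_sumr -!big_split /=; apply: eq_bigr => j _.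
  by rewrite !scalerA -!scalerDl.
by rewrite (combE _ _ _ u v w hu0 Z hZ) (combE _ _ _ c b a hc0 X hX)
  (combE _ _ _ u v w hu0 Z hZ) -hX -!hZ hZX subrr.
Qed.

Let eqSn n : ((n.+1 == n) = false) * ((n.+2 == n) = false)
  * ((n.+3 == n) = false) * ((n.+4 == n) = false).
Proof. by do !split; elim: n. Qed.
Let eqnS n : ((n == n.+1) = false) * ((n == n.+2) = false) * ((n == n.+3) = false)
  * ((n == n.+4) = false).
Proof. by do !split; rewrite eq_sym eqSn. Qed.
Let eqns := (eqSS, eqSn, eqnS, eqxx, mulr1n, mulr0n, addr0, add0r, mulr0).

(** This lemma and the next five read [comm_coord] along its five diagonals; the main one is split
    because no lower neighbour exists at n = 0. *)
Lemma comm_raise2 n : a n * w n.+1 - w n * a n.+1 = w n * w n.+1.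
Proof.
have := @comm_coord n n.+2 (leqnn _).
by case: n => [|n]; rewrite /tridiag /= ?eqns // ?hc0 ?hu0 ?mul0r ?add0r.
Qed.

Lemma comm_raise1 n :
  b n * w n + a n * v n.+1 - (v n * a n + w n * b n.+1) = v n * w n + w n * v n.+1.
Proof.
have := @comm_coord n n.+1 (leqW (leqnn _)).
by case: n => [|n]; rewrite /tridiag /= ?eqns // ?hc0 ?hu0 ?mul0r ?add0r.
Qed.

Lemma comm_diag0 : a 0%N * u 1%N - w 0%N * c 1%N = v 0%N ^+ 2 + w 0%N * u 1%N.
Proof.
have := @comm_coord 0 0 isT.
rewrite /tridiag /= ?eqns hc0 hu0 !mul0r !add0r => <-; ring.
Qed.

Lemma comm_diagS n :
  c n.+1 * w n + a n.+1 * u n.+2 - (u n.+1 * a n + w n.+1 * c n.+2)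
  = u n.+1 * w n + v n.+1 ^+ 2 + w n.+1 * u n.+2.
Proof.
have := @comm_coord n.+1 n.+1 (leqW (leqW (leqnn _))).
rewrite /tridiag /= ?eqns expr2 => <-; ring.
Qed.

Lemma comm_lower1 n :
  c n.+1 * v n + b n.+1 * u n.+1 - (u n.+1 * b n + v n.+1 * c n.+1)
  = u n.+1 * v n + v n.+1 * u n.+1.
Proof.
have := @comm_coord n.+1 n; rewrite /tridiag /= ?eqns; apply.
by do 3!apply: ltnW.
Qed.

Lemma comm_lower2 n : c n.+2 * u n.+1 - u n.+2 * c n.+1 = u n.+2 * u n.+1.
Proof.
have := @comm_coord n.+2 n; rewrite /tridiag /= ?eqns; apply.
by do 4!apply: ltnW.
Qed.

End Coordinates.

(** * Closed forms of the matrix entries *)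

(* The factor (K + n) / (K + 2 n) of the recurrence coefficients; at n = 0 it
   has to be read as 1, also when K = 0. *)
Definition rho {F : fieldType} (K : F) (n : nat) : F :=
  if n is 0 then 1 else (K + n%:R) / (K + 2 * n%:R).

Lemma mul_rho (F : fieldType) (K : F) (hK : forall k, K + k.+1%:R != 0) n :
  (K + 2 * n%:R) * rho K n = K + n%:R.
Proof.
case: n => [|n] /=; first by rewrite mulr0 mulr1.
have := hK (2 * n).+1; rewrite -[(2 * n).+2]/(2 + 2 * n)%N -mulnS natrM => nz.
by rewrite mulrC divfK.
Qed.

Section ClosedForms.

Variables (F : numFieldType) (a b c u v w : nat -> F) (delta phi : F).
Hypotheses (hu : forall n, u n.+1 != 0) (hw : forall n, w n != 0).
Hypothesis raise2 : forall n, a n * w n.+1 - w n * a n.+1 = w n * w n.+1.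
Hypothesis raise1 : forall n,
  b n * w n + a n * v n.+1 - (v n * a n + w n * b n.+1) = v n * w n + w n * v n.+1.
Hypothesis diag0 : a 0%N * u 1%N - w 0%N * c 1%N = v 0%N ^+ 2 + w 0%N * u 1%N.
Hypothesis diagS : forall n,
  c n.+1 * w n + a n.+1 * u n.+2 - (u n.+1 * a n + w n.+1 * c n.+2)
  = u n.+1 * w n + v n.+1 ^+ 2 + w n.+1 * u n.+2.
Hypothesis lower1 : forall n,
  c n.+1 * v n + b n.+1 * u n.+1 - (u n.+1 * b n + v n.+1 * c n.+1)
  = u n.+1 * v n + v n.+1 * u n.+1.
Hypothesis lower2 : forall n, c n.+2 * u n.+1 - u n.+2 * c n.+1 = u n.+2 * u n.+1.
Hypotheses (hdelta : delta = a 0%N / w 0%N) (hphi : phi = c 1%N / u 1%N - 1).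

Local Notation K := (phi - delta).
Hypothesis hK : forall k, K + k.+1%:R != 0.
Hypothesis hv0 : v 0%N = 2 / (K + 1).
Hypothesis hb0 : b 0%N = 2^-1 * (delta + phi + 1) * v 0%N.

(** Divided by w_n w_(n+1), [raise2] says that a_n / w_n drops by 1 at each step; [lower2] likewise
    makes c_n / u_n grow by 1. *)
Lemma a_ratio n : a n = (delta - n%:R) * w n.
Proof.
elim: n => [|n IHn]; first by rewrite hdelta subr0 divfK.
apply: (mulfI (hw n)); transitivity (a n * w n.+1 - w n * w n.+1).
  by rewrite -raise2; ring.
by rewrite IHn; ring.
Qed.

Lemma c_ratio n : c n.+1 = (phi + n.+1%:R) * u n.+1.
Proof.
elim: n => [|n IHn]; first by rewrite hphi subrK divfK.
apply: (mulfI (hu n)); transitivity (u n.+2 * c n.+1 + u n.+2 * u n.+1).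
  by rewrite -lower2; ring.
by rewrite IHn; ring.
Qed.

Lemma raise1_ratio n :
  b n - b n.+1 + (delta - n%:R) * (v n.+1 - v n) = v n + v n.+1.
Proof.
apply: (mulfI (hw n)); transitivity (v n * w n + w n * v n.+1); last by ring.
by rewrite -raise1 a_ratio; ring.
Qed.

Lemma lower1_ratio n :
  b n.+1 - b n + (phi + n.+1%:R) * (v n - v n.+1) = v n + v n.+1.
Proof.
apply: (mulfI (hu n)); transitivity (u n.+1 * v n + v n.+1 * u n.+1); last by ring.
by rewrite -lower1 c_ratio; ring.
Qed.

(** Adding [raise1_ratio] and [lower1_ratio] eliminates b. *)
Lemma v_rec n : (K + 2 * n%:R + 3) * v n.+1 = (K + 2 * n%:R - 1) * v n.
Proof.
have : v n + v n.+1 + (v n + v n.+1) = b n - b n.+1 + (delta - n%:R) * (v n.+1 - v n)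
  + (b n.+1 - b n + (phi + n.+1%:R) * (v n - v n.+1))
  by rewrite raise1_ratio lower1_ratio.
move=> h; apply/eqP; rewrite -subr_eq0; apply/eqP.
move/eqP: h; rewrite -subr_eq0 => /eqP <-; ring.
Qed.

(** Subtracting the two ratio equations eliminates v_n + v_(n+1), so b and v have proportional
    increments; [hb0] starts the induction. *)
Lemma b_proportional_v n : b n = 2^-1 * (delta + phi + 1) * v n.
Proof.
elim: n => [//|n IHn].
have two0 : (2 : F) != 0 by rewrite Num.Theory.pnatr_eq0.
apply: (mulfI two0).
have h1 := raise1_ratio n; have h2 := lower1_ratio n; rewrite IHn in h1 h2.
transitivity (2 * (2^-1 * (delta + phi + 1) * v n)
  + (delta + phi + 1) * (v n.+1 - v n)); last by field.
apply/eqP; rewrite -subr_eq0; apply/eqP.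
transitivity ((b n.+1 - 2^-1 * (delta + phi + 1) * v n +
     (phi + n.+1%:R) * (v n - v n.+1)) - (2^-1 * (delta + phi + 1) * v n - b n.+1 +
     (delta - n%:R) * (v n.+1 - v n))).
  by ring.
by rewrite h1 h2 subrr.
Qed.

Lemma K_neq0 m n : K + 2 * n%:R + m.+1%:R != 0.
Proof. by have := hK (2 * n + m)%N; rewrite -addnS natrD natrM addrA. Qed.

(** The product given by [v_rec] telescopes with a shift of two factors. Index 0 is left out because
    there the formula would read (K - 1) / (K - 1), and K = 1 is allowed. *)
Lemma v_closed n : v n.+1 = 2 * (K - 1) / ((K + 2 * n%:R + 1) * (K + 2 * n%:R + 3)).
Proof.
have h1 := K_neq0 0; have h3 := K_neq0 2.
elim: n => [|n IHn].
  apply: (mulfI (h3 0%N)); rewrite v_rec hv0; field.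
  by have := h1 0%N; have := h3 0%N; rewrite mulr0 addr0 => -> ->.
apply: (mulfI (h3 n.+1)); rewrite v_rec IHn; field.
by rewrite nat1r h3 !h1.
Qed.

Lemma uw_closed n : u n.+1 * w n =
  - 4 * n.+1%:R * rho K n / ((K + 2 * n%:R + 1) ^+ 2 * (K + 2 * n%:R + 2)).
Proof.
have h1 := K_neq0 0; have h2 := K_neq0 1; have h3 := K_neq0 2.
elim: n => [|n IHn].
  have := h1 0%N; have := h2 0%N; rewrite /= mulr0 !addr0 => h20 h10.
  apply: (mulfI h20); transitivity (- v 0%N ^+ 2).
    by rewrite -[v 0%N ^+ 2](addrK (w 0%N * u 1%N)) -diag0 a_ratio c_ratio; ring.
  by rewrite hv0; field; rewrite h10 h20.
have h4 := K_neq0 3 n; apply: (mulfI h4).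
transitivity ((K + 2 * n%:R) * (u n.+1 * w n) - v n.+1 ^+ 2).
  apply/eqP; rewrite -subr_eq0 -oppr_eq0; apply/eqP.
  have /eqP := diagS n; rewrite -subr_eq0 !a_ratio !c_ratio => /eqP <-; ring.
(* The factor K + 2n, which may vanish at n = 0, is absorbed by [mul_rho] instead of being
   cancelled. *)
transitivity (- 4 * n.+1%:R * (K + n%:R)
  / ((K + 2 * n%:R + 1) ^+ 2 * (K + 2 * n%:R + 2)) - v n.+1 ^+ 2).
  by rewrite IHn -(mul_rho _ _ hK); field; rewrite h1 h2.
rewrite v_closed /=; field.
by rewrite nat1r !h1 h2 -[n.+1%:R]natr1 mulrDr mulr1 addrA h2.
Qed.

End ClosedForms.

(** * Pochhammer symbols and the monic Jacobi recurrence *)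

Lemma pochhammerSr (F : fieldType) (y : F) n :
  pochhammer y n.+1 = pochhammer y n * (y + n%:R).
Proof. by rewrite /pochhammer big_ord_recr. Qed.

Lemma pochhammerSl (F : fieldType) (y : F) n :
  pochhammer y n.+1 = y * pochhammer (y + 1) n.
Proof.
rewrite /pochhammer big_ord_recl /= addr0; congr (_ * _).
by apply: eq_bigr => i _; rewrite -addrA nat1r.
Qed.

Lemma pochhammer0 (F : fieldType) (y : F) : pochhammer y 0 = 1.
Proof. by rewrite /pochhammer big_ord0. Qed.

Lemma pochhammer_neq0 (F : fieldType) (y : F) n :
  (forall k, y + k%:R != 0) -> pochhammer y n != 0.
Proof. by move=> hy; apply/prodf_neq0 => i _; apply: hy. Qed.

(* In terms of the parameters, A = alpha + 1 and K = alpha + beta + 1. *)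
Section Jacobi.

Variables (F : numFieldType) (A K : F).
Hypotheses (hA : forall k, A + k%:R != 0) (hK : forall k, K + k.+1%:R != 0).

(** This is the monic normalization times (alpha + 1)_n / n!, with n! cancelled. *)
Let jac_norm n : F := 2 ^+ n * pochhammer A n / pochhammer (n%:R + K) n.
Let hypcoef n k : F :=
  pochhammer (- n%:R) k * pochhammer (n%:R + K) k / (pochhammer A k * k`!%:R).

(** Padding with the zero terms k > n lets series of different degrees be summed over one common
    range. *)
Lemma hyp2F1_negE n N (z : {poly F}) : (n < N)%N ->
  hyp2F1_neg n (n%:R + K) A z = \sum_(k < N) hypcoef n k *: z ^+ k.
Proof.
move=> ltnN; rewrite -(subnKC ltnN); elim: (N - _)%N => [|d IHd].
  by rewrite addn0.
rewrite addnS big_ord_recr /= -IHd /hypcoef pochhammer_opp_nat ?leq_addr //.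
by rewrite !mul0r scale0r addr0.
Qed.

Let two_neq0 : 2 != 0 :> F. Proof. by rewrite Num.Theory.pnatr_eq0. Qed.

Lemma den_neq0 m (n := m.+1%:R) :
  [&& K + 2 * n - 1 != 0, K + 2 * n != 0 & K + 2 * n + 1 != 0].
Proof.
have -> : K + 2 * n = K + (m + m)%N.+1%:R + 1.
  by rewrite -addrA natr1 -natrM mulnC muln2 doubleS addnn.
by rewrite addrK -![K + _ + 1]addrA !natr1 !hK.
Qed.

Lemma jac_norm1 : jac_norm 1 = 2 * A / (K + 1).
Proof.
by rewrite /jac_norm !pochhammerSr !pochhammer0 expr1 !mul1r !addr0 [1 + K]addrC.
Qed.

Lemma jac_normS n :
  jac_norm n.+1 = 2 * jac_norm n * (A + n%:R) * rho K n / (K + 2 * n%:R + 1).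
Proof.
case: n => [|m].
  by rewrite jac_norm1 /jac_norm !pochhammer0 expr0 divr1 /= mulr0 !mulr1 !addr0.
rewrite /= /jac_norm; set n := m.+1.
have Kn : n%:R + K != 0 by rewrite addrC; apply: hK.
(* Both sides times n + K equal (n + K)_(n+2). This factor is nonzero only because n >= 1, hence the
   separate case n = 0. *)
have e1 : pochhammer (n.+1%:R + K) n.+1 = pochhammer (n%:R + K) n
    * (K + 2 * n%:R) * (K + 2 * n%:R + 1) / (n%:R + K).
  apply: (mulfI Kn); rewrite -natr1 addrAC -pochhammerSl !pochhammerSr.
  by rewrite -[n.+1%:R]natr1; field.
have P0 : pochhammer (n%:R + K) n != 0.
  by apply: pochhammer_neq0 => k; rewrite addrAC addrC -natrD addSn.
have /and3P[_ k1 k2] := den_neq0 m; rewrite -/n in k1 k2.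
rewrite e1 [pochhammer A n.+1]pochhammerSr exprS; field.
by rewrite k1 k2 P0 Kn.
Qed.

(** This is the coefficient of z^(j+1), z = (1 - X) / 2, in the recurrence divided by
    [jac_norm m.+1]; on the left, X = 1 - 2z. *)
Lemma jac_coef_recS m j :
  let n := m.+1%:R in
  hypcoef m.+1 j.+1 - 2 * hypcoef m.+1 j =
  2 * (A + n) * (K + n) / ((K + 2 * n) * (K + 2 * n + 1)) * hypcoef m.+2 j.+1
  + (K - 2 * A + 1) * (K - 1) / ((K + 2 * n - 1) * (K + 2 * n + 1)) * hypcoef m.+1 j.+1
  + 2 * n * (K - A + n) / ((K + 2 * n - 1) * (K + 2 * n)) * hypcoef m j.+1.
Proof.
move=> n.
have nz : n != 0 by rewrite Num.Theory.pnatr_eq0.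
have Kn : n + K != 0 by rewrite addrC; apply: hK.
have /and3P[k3 k2 k1] := den_neq0 m; rewrite -/n in k1 k2 k3.
have mE : m%:R = n - 1 by rewrite /n -natr1 addrK.
have mSSE : m.+2%:R = n + 1 by rewrite natr1.
rewrite /hypcoef mE mSSE -[m.+1%:R]/n; clearbody n.
(* Every shifted symbol is a rational multiple of B or G, which leaves a rational identity for
   [field]. *)
set B := pochhammer (- n) j; set G := pochhammer (n + K) j.
have e1 : pochhammer (- (n + 1)) j.+1 = - (n + 1) * B.
  by rewrite pochhammerSl opprD subrK.
have e2 : pochhammer (- (n - 1)) j.+1 = B * (j%:R - n) * (j%:R - n + 1) / (- n).
  apply: (mulfI (x := - n)); first by rewrite oppr_eq0.
  rewrite opprB addrC -pochhammerSl !pochhammerSr -/B -[j.+1%:R]natr1; field.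
  by rewrite nz.
have e3 : pochhammer (n + 1 + K) j.+1 =
    G * (n + K + j%:R) * (n + K + j%:R + 1) / (n + K).
  apply: (mulfI Kn).
  rewrite addrAC -pochhammerSl !pochhammerSr -/G -[j.+1%:R]natr1; field.
  by rewrite Kn.
have e4 : pochhammer (n - 1 + K) j.+1 = (n + K - 1) * G.
  by rewrite pochhammerSl addrAC subrK.
rewrite e1 e2 e3 e4 !pochhammerSr -/B -/G factS natrM.
have P0 : pochhammer A j != 0 by apply: pochhammer_neq0.
have f0 : j`!%:R != 0 :> F by rewrite Num.Theory.pnatr_eq0 -lt0n fact_gt0.
have j0 : j.+1%:R != 0 :> F by rewrite Num.Theory.pnatr_eq0.
have Aj := hA j.
clearbody B G. field.
by rewrite nat1r f0 j0 Aj P0 nz k1 k2 k3 Kn.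
Qed.

Lemma hypcoef0 n : hypcoef n 0 = 1.
Proof. by rewrite /hypcoef !pochhammer0 !mul1r invr1. Qed.

Lemma jac_coef_rec0 m :
  let n := m.+1%:R in
  1 = 2 * (A + n) * (K + n) / ((K + 2 * n) * (K + 2 * n + 1))
  + (K - 2 * A + 1) * (K - 1) / ((K + 2 * n - 1) * (K + 2 * n + 1))
  + 2 * n * (K - A + n) / ((K + 2 * n - 1) * (K + 2 * n)).
Proof.
move=> n; have /and3P[k3 k2 k1] := den_neq0 m; rewrite -/n in k1 k2 k3.
by clearbody n; field; rewrite k1 k2 k3.
Qed.

Local Notation z := (2^-1 *: (1 - 'X) : {poly F}).

Lemma mulX_hyp2F1 n N : (n < N)%N ->
  'X * hyp2F1_neg n (n%:R + K) A z
  = 1 + \sum_(j < N) (hypcoef n j.+1 - 2 * hypcoef n j) *: z ^+ j.+1.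
Proof.
move=> ltnN; have {1}-> : 'X = 1 - 2 *: z.
  by rewrite scalerA divff // scale1r opprB addrC subrK.
rewrite mulrBl mul1r {1}(@hyp2F1_negE n N.+1) ?(leqW ltnN) //.
rewrite (@hyp2F1_negE n N) // big_ord_recl hypcoef0 scale1r expr0 -addrA; congr (_ + _).
rewrite mulr_sumr -sumrB; apply: eq_bigr => j _ /=.
by rewrite -scalerAl -scalerAr !scalerA -exprS -scalerBl.
Qed.

Lemma hyp2F1_recl n N : (n <= N)%N ->
  hyp2F1_neg n (n%:R + K) A z = 1 + \sum_(j < N) hypcoef n j.+1 *: z ^+ j.+1.
Proof.
move=> lenN; rewrite (@hyp2F1_negE n N.+1) // big_ord_recl hypcoef0 scale1r expr0.
by [].
Qed.

Definition monic_jacobi n : {poly F} := jac_norm n *: hyp2F1_neg n (n%:R + K) A z.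

Lemma monic_jacobi0 : monic_jacobi 0 = 1.
Proof.
by rewrite /monic_jacobi (@hyp2F1_recl 0 0) // big_ord0 addr0 /jac_norm !pochhammer0 expr0
  divr1 mulr1 scale1r.
Qed.

(** The step n = 0 stands apart because the general middle coefficient degenerates to (K - 1) / (K -
    1) there. *)
Lemma monic_jacobi1 :
  'X * monic_jacobi 0 = monic_jacobi 1 + ((K - 2 * A + 1) / (K + 1)) *: monic_jacobi 0.
Proof.
rewrite monic_jacobi0 /monic_jacobi (@hyp2F1_recl 1 1) // big_ord1 jac_norm1.
have K1 : K + 1 != 0 by have := hK 0.
have A0 : A != 0 by have := hA 0; rewrite addr0.
have -> : hypcoef 1 1 = - (K + 1) / A.
  rewrite /hypcoef !pochhammerSr !pochhammer0 !mul1r !addr0 factS fact0; field; exact: A0.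
rewrite expr1 scalerDr !scalerA.
have -> : 2 * A / (K + 1) * (- (K + 1) / A) / 2 = - 1 by field; rewrite K1 A0.
rewrite scaleN1r opprB addrAC -scalerDl.
have -> : 2 * A / (K + 1) + (K - 2 * A + 1) / (K + 1) = 1 by field; exact: K1.
by rewrite scale1r mulr1 addrC subrK.
Qed.

(** Here g plays the role of a_(n-1) c_n; the hypothesis is stated without quotients, so that the
    factor [rho] shared by [uw_closed] and [jac_normS] can be matched on both sides. *)
Lemma monic_jacobiS m g : let n := m.+1%:R in
  g * jac_norm m * ((K + 2 * n - 1) * (K + 2 * n))
    = 2 * n * (K - A + n) * jac_norm m.+1 ->
  'X * monic_jacobi m.+1 = monic_jacobi m.+2
  + ((K - 2 * A + 1) * (K - 1) / ((K + 2 * n - 1) * (K + 2 * n + 1)))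
      *: monic_jacobi m.+1
  + g *: monic_jacobi m.
Proof.
move=> n hg; have /and3P[k3 k2 k1] := den_neq0 m; rewrite -/n in k1 k2 k3.
have {}hg : g * jac_norm m = jac_norm m.+1
    * (2 * n * (K - A + n) / ((K + 2 * n - 1) * (K + 2 * n))).
  apply: (mulIf (mulf_neq0 k3 k2)); by rewrite hg; clearbody n; field; rewrite k2 k3.
have hC : jac_norm m.+2 = jac_norm m.+1 *
    (2 * (A + n) * (K + n) / ((K + 2 * n) * (K + 2 * n + 1))).
  by rewrite jac_normS /= -/n; clearbody n; field; rewrite k1 k2.
have ht := jac_coef_recS m; have ht0 := jac_coef_rec0 m.
move: hg hC ht ht0; rewrite -/n /=.
set xa := 2 * (A + n) * _ / _; set xb := (K - 2 * A + 1) * _ / _; set xc := 2 * n * _ / _.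
clearbody xa xb xc => hg hC ht ht0.
rewrite /monic_jacobi -scalerAr.
rewrite (@mulX_hyp2F1 m.+1 m.+2) // !(@hyp2F1_recl _ m.+2) ?leqnSn //;
  last by rewrite ltnW.
clearbody jac_norm hypcoef; rewrite hC !scalerA hg [xb * _]mulrC -!scalerA.
rewrite -!scalerDr; congr (_ *: _).
under eq_bigr => j _ do rewrite ht !scalerDl -!scalerA.
(* By [ht0] the constant term 1 splits as xa + xb + xc, one share for each of the three series. *)
rewrite !big_split /= -!scaler_sumr -[X in X + _ = _]scale1r {1}ht0 !scalerDl.
rewrite ![_ *: (1 + _)]scalerDr; ring.
Qed.

End Jacobi.

(** * Identification of p_n with the Jacobi polynomials *)

(* At n = 0 the terms involving the index n.-1 vanish because c 0 = u 0 = 0. *)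
Theorem proposition1 (R : realType) (V : lmodType R[i]) (e : nat -> V)
    (he : is_basis e)
    (X Z : {linear V -> V})
    (hZX : forall x : V, Z (X x) - X (Z x) = Z (Z x))
    (a b c u v w : nat -> R[i])
    (hX : forall n : nat,
        X (e n) = c n *: e n.-1 + b n *: e n + a n *: e n.+1)
    (hZ : forall n : nat,
        Z (e n) = u n *: e n.-1 + v n *: e n + w n *: e n.+1)
    (hc0 : c 0%N = 0) (hu0 : u 0%N = 0)
    (hc : forall n : nat, (1 <= n)%N -> c n <> 0)
    (hu : forall n : nat, (1 <= n)%N -> u n <> 0)
    (ha : forall n : nat, a n <> 0)
    (hw : forall n : nat, w n <> 0)
    (delta0 phi0 bt0 : R[i])
    (hdelta0 : delta0 = a 0%N / w 0%N)
    (hphi0 : phi0 = c 1%N / u 1%N - 1)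
    (hbt0 : bt0 = b 0%N - 2^-1 * (delta0 + phi0 + 1) * v 0%N)
    (hdiff : forall k : nat, (1 <= k)%N -> phi0 - delta0 <> - k%:R)
    (hnorm_v0 : v 0%N = 2 / (phi0 - delta0 + 1))
    (hnorm_bt0 : bt0 = 0)
    (p : nat -> {poly R[i]})
    (hp0 : p 0%N = 1)
    (hp : forall n : nat,
        'X * p n = p n.+1 + b n *: p n + (a n.-1 * c n) *: p n.-1)
    (alpha beta : R[i])
    (halpha : alpha = - delta0 - 1)
    (hbeta : beta = phi0) :
  forall n : nat,
    p n = (2 ^+ n * n`!%:R / pochhammer (n%:R + alpha + beta + 1) n)
            *: jacobi n alpha beta.
Proof.
have hu' n : u n.+1 != 0 by apply/eqP; apply: hu.
have hw' n : w n != 0 by apply/eqP.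
have hK k : phi0 - delta0 + k.+1%:R != 0.
  by rewrite addr_eq0; apply/eqP; apply: hdiff.
have hb0 : b 0%N = 2^-1 * (delta0 + phi0 + 1) * v 0%N.
  by apply/eqP; rewrite -subr_eq0 -hbt0 hnorm_bt0.
have raise2 := comm_raise2 _ _ _ _ _ _ _ _ _ _ _ he hZX hX hZ hc0 hu0.
have raise1 := comm_raise1 _ _ _ _ _ _ _ _ _ _ _ he hZX hX hZ hc0 hu0.
have diag0 := comm_diag0 _ _ _ _ _ _ _ _ _ _ _ he hZX hX hZ hc0 hu0.
have diagS := comm_diagS _ _ _ _ _ _ _ _ _ _ _ he hZX hX hZ hc0 hu0.
have lower1 := comm_lower1 _ _ _ _ _ _ _ _ _ _ _ he hZX hX hZ hc0 hu0.
have lower2 := comm_lower2 _ _ _ _ _ _ _ _ _ _ _ he hZX hX hZ hc0 hu0.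
have ha_eq := a_ratio _ _ _ _ hw' raise2 hdelta0.
have hc_eq := c_ratio _ _ _ _ hu' lower2 hphi0.
have hb_eq := b_proportional_v _ _ _ _ _ _ _ _ _ hu' hw' raise2 raise1
  lower1 lower2 hdelta0 hphi0 hb0.
have hv_eq := v_closed _ _ _ _ _ _ _ _ _ hu' hw' raise2 raise1 lower1
  lower2 hdelta0 hphi0 hK hnorm_v0.
have huw_eq := uw_closed _ _ _ _ _ _ _ _ _ hu' hw' raise2 raise1 diag0
  diagS lower1 lower2 hdelta0 hphi0 hK hnorm_v0.
(* Since a_k = (delta0 - k) w_k is nonzero, no (alpha + 1)_k in a denominator vanishes. *)
have hA k : - delta0 + k%:R != 0.
  rewrite -oppr_eq0 opprD opprK; apply: contra_not_neq (ha k) => h0.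
  by rewrite ha_eq h0 mul0r.
set K := phi0 - delta0 in hK hv_eq huw_eq hnorm_v0.
(* The recurrence has order two, so the induction carries two consecutive indices. *)
suff pE n : p n = monic_jacobi _ (- delta0) K n /\
    p n.+1 = monic_jacobi _ (- delta0) K n.+1.
  move=> n; rewrite (pE n).1 /monic_jacobi /jacobi hbeta.
  have -> : alpha + 1 = - delta0 by rewrite halpha subrK.
  have -> : n%:R + alpha + phi0 + 1 = n%:R + K by rewrite halpha /K; ring.
  rewrite scalerA; congr (_ *: _).
  have f0 : n`!%:R != 0 :> R[i] by rewrite Num.Theory.pnatr_eq0 -lt0n fact_gt0.
  by move: (pochhammer (n%:R + K) n)^-1 => q; field.
have p1 : p 1%N = monic_jacobi _ (- delta0) K 1.
  have := hp 0%N; rewrite hc0 mulr0 scale0r addr0 hp0 -(monic_jacobi0 _ (- delta0) K).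
  rewrite monic_jacobi1 // => h.
  have b0E : b 0%N = (K - 2 * - delta0 + 1) / (K + 1).
    by rewrite hb0 hnorm_v0 /K; field; exact: (hK 0%N).
  by apply/esym/(addIr (b 0%N *: monic_jacobi _ (- delta0) K 0)); rewrite -h b0E.
elim: n => [|n [IH0 IH1]]; first by rewrite hp0 monic_jacobi0.
split=> //; have := hp n.+1; rewrite IH1 /= IH0.
have /and3P[k3 k2 k1] := den_neq0 _ K hK n.
rewrite (monic_jacobiS _ _ _ hA hK n (a n * c n.+1)); last first.
  rewrite (jac_normS _ _ _ hK) ha_eq hc_eq.
  (* Regrouping isolates the product s_n = u_(n+1) w_n, the only combination of u and w with a known
     closed form. *)
  rewrite (_ : (_ - _) * w n * (_ * u n.+1)
     = (delta0 - n%:R) * (phi0 + n.+1%:R) * (u n.+1 * w n)); last by ring.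
  rewrite huw_eq.
  set C := 2 ^+ n * _ / _; set r := rho K n.
  have d1 : phi0 - delta0 + 2 * n%:R + 1 != 0 by apply: (K_neq0 _ _ _ hK 0).
  have d2 : phi0 - delta0 + 2 * n%:R + 2 != 0 by apply: (K_neq0 _ _ _ hK 1).
  by rewrite /K; clearbody C r; field; rewrite d1 d2.
have bE : b n.+1 = (K - 2 * - delta0 + 1) * (K - 1)
    / ((K + 2 * n.+1%:R - 1) * (K + 2 * n.+1%:R + 1)).
  rewrite hb_eq hv_eq.
  have -> : K + 2 * n.+1%:R - 1 = K + 2 * n%:R + 1 by rewrite -natr1; ring.
  have -> : K + 2 * n.+1%:R + 1 = K + 2 * n%:R + 3 by rewrite -natr1; ring.
  have d1 : phi0 - delta0 + 2 * n%:R + 1 != 0 by apply: (K_neq0 _ _ _ hK 0).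
  have d3 : phi0 - delta0 + 2 * n%:R + 3 != 0 by apply: (K_neq0 _ _ _ hK 2).
  by rewrite /K; field; rewrite d1 d3.
by rewrite -bE => /addIr/addIr.
Qed.
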